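(* Let $G$ be a connected simple graph of order $n$ with clique number $\omega\ge 2$, and write $n=k\omega+r$ with integers $k\ge 0$ and $0\le r<\omega$. Then $$q_1(G)\le \frac{(3\omega-4)k+3r-2+\sqrt{k^2\omega^2+[(2r+4)\omega-8r]k+(r-2)^2}}{2}.$$ Moreover, equality holds if and only if $G$ is a complete bipartite graph when $\omega=2$, and $G$ is the Tur\'an graph $T_{n,\omega}$ when $\omega\ge 3$.
   Context: All graphs are finite, simple and undirected. For a graph $G$, $Q(G)=D(G)+A(G)$ is the signless Laplacian matrix, where $A(G)$ is the adjacency matrix and $D(G)$ the diagonal matrix of vertex degrees; $q_1(G)$ denotes the largest eigenvalue of $Q(G)$ (the signless Laplacian spectral radius). The clique number $\omega$ is the order of a largest complete subgraph. The Tur\'an graph $T_{n,t}$ is the complete $t$-partite graph on $n$ vertices whose parts have sizes $\lfloor n/t\rfloor$ or $\lceil n/t\rceil$. *)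

(* Defs.v *)
From HB Require Import structures.
From mathcomp Require Import all_boot all_order all_algebra.
From mathcomp Require Import all_classical all_reals.
From mathcomp Require Import complex polyrcf.

Set Implicit Arguments.
Unset Strict Implicit.
Unset Printing Implicit Defensive.

Import Order.TTheory GRing.Theory Num.Theory.

Local Open Scope ring_scope.

(* A finite simple graph is a symmetric irreflexive relation [e] on its
   finite vertex type [T]; its order is [#|T|]. *)
Definition simple_graph (T : finType) (e : rel T) : Prop :=
  symmetric e /\ irreflexive e.

Definition connected_graph (T : finType) (e : rel T) : Prop :=
  forall x y : T, connect e x y.

Definition clique (T : finType) (e : rel T) (A : {set T}) : bool :=
  [forall x in A, forall y in A, (x != y) ==> e x y].

Definition clique_number (T : finType) (e : rel T) : nat :=
  (\max_(A : {set T} | clique e A) #|A|)%N.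

Definition degree (T : finType) (e : rel T) (x : T) : nat := #|[set y | e x y]|.

(* Matrix rows and columns are indexed by vertices through [enum_val]. *)
Definition adjacency_mx (R : realType) (T : finType) (e : rel T) : 'M[R]_#|T| :=
  \matrix_(i, j) (e (enum_val i) (enum_val j))%:R.

Definition degree_mx (R : realType) (T : finType) (e : rel T) : 'M[R]_#|T| :=
  diag_mx (\row_i (degree e (enum_val i))%:R).

Definition signless_laplacian (R : realType) (T : finType) (e : rel T) :
    'M[R]_#|T| :=
  degree_mx R e + adjacency_mx R e.

(* This supremum is the largest eigenvalue when [T] is inhabited: see [q1P]. *)
Definition q1 (R : realType) (T : finType) (e : rel T) : R :=
  sup [set a : R | eigenvalue (signless_laplacian R e) a]%classic.

Lemma sym_eigenvalue (R : realType) n (A : 'M[R]_n) :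
  (0 < n)%N -> A^T = A -> exists a, eigenvalue A a.
Proof.
move=> n_gt0 A_sym; pose f := real_complex R; pose B := map_mx f A.
have [z] : exists z : R[i], root (char_poly B) z.
  by apply/closed_rootP; rewrite size_char_poly eqSS -lt0n.
rewrite -eigenvalue_root_char => Bz.
have /eigenvalueP[v vB v_neq0] := Bz.
pose vc := (map_mx Num.conj v)^T; pose s := v *m vc.
have cB : map_mx Num.conj B = B.
  by apply/matrixP=> i j; rewrite !mxE conj_Creal// complex_real.
have sB : B^T = B by apply/matrixP=> i j; rewrite !mxE -{1}A_sym mxE.
have sE : s 0 0 = \sum_i v 0 i * (v 0 i)^*.
  by rewrite mxE; apply: eq_bigr => i _; rewrite !mxE.
have s_neq0 : s 0 0 != 0.
  apply: contra v_neq0; rewrite sE psumr_eq0; last by move=> i _; exact: mul_conjC_ge0.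
  move=> /allP v0; apply/eqP/rowP => i; rewrite mxE.
  by apply/eqP; rewrite -mul_conjC_eq0; apply: v0; rewrite mem_index_enum.
have Bvc : B *m vc = z^* *: vc.
  rewrite -{1}sB /vc -trmx_mul -{1}cB -map_mxM vB map_mxZ linearZ //.
have : z *: s = z^* *: s by rewrite scalemxAl -vB -mulmxA Bvc scalemxAr.
move=> /matrixP/(_ 0 0); rewrite [LHS]mxE [RHS]mxE => /(mulIf s_neq0) zE.
have /complex_realP[a zfa] : z \is Num.real by rewrite CrealE -zE.
exists a; rewrite zfa in Bz.
by move: Bz; rewrite eigenvalue_map.
Qed.

Lemma q1P (R : realType) (T : finType) (e : rel T) :
    (0 < #|T|)%N -> symmetric e ->
  eigenvalue (signless_laplacian R e) (q1 R e) /\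
  forall a, eigenvalue (signless_laplacian R e) a -> a <= q1 R e.
Proof.
move=> T_gt0 e_sym; set A := signless_laplacian R e.
have A_sym : A^T = A.
  rewrite /A /signless_laplacian linearD/= tr_diag_mx; congr (_ + _).
  by apply/matrixP => i j; rewrite !mxE e_sym.
have [a0 Aa0] := sym_eigenvalue T_gt0 A_sym.
have p_neq0 : char_poly A != 0 by rewrite monic_neq0// char_poly_monic.
have specE a : eigenvalue A a = (a \in rootsR (char_poly A)).
  by rewrite eigenvalue_root_char -(roots_on_rootsR p_neq0) in_itv.
have max_mem (s : seq R) : a0 \in s ->
    exists2 c, c \in s & {in s, forall x, x <= c}.
  case: s => // x s _; elim: s x => [|y s IH] x.
    by exists x => [|y]; rewrite !inE // => /eqP->.
  have [c c_in c_max] := IH y; exists (Num.max x c) => [|z].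
    by rewrite inE; case: leP => _; rewrite ?eqxx ?c_in ?orbT.
  by rewrite inE le_max => /predU1P[->|/c_max->]; rewrite ?lexx ?orbT.
have := max_mem (rootsR (char_poly A)); rewrite -specE => /(_ Aa0)[c].
rewrite -specE => Ac le_c.
suff -> : q1 R e = c by split=> // a; rewrite specE => /le_c.
have ubc : ubound [set a | eigenvalue A a]%classic c.
  by move=> a /=; rewrite specE => /le_c.
apply/le_anti/andP; split; first by apply: ge_sup => //; exists c.
by apply: ub_le_sup => //; exists c.
Qed.

(* [c] assigns to each vertex its part, so that part [i] is [c @^-1: [set i]]. *)
Definition complete_partite (t : nat) (T : finType) (e : rel T)
    (c : T -> 'I_t) : Prop :=
  forall x y : T, e x y = (c x != c y).

Definition complete_bipartite (T : finType) (e : rel T) : Prop :=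
  exists c : T -> 'I_2,
    complete_partite e c /\ forall i : 'I_2, exists x : T, c x = i.

Definition ceil_div (n t : nat) : nat := ((n + t.-1) %/ t)%N.

Definition is_turan (t : nat) (T : finType) (e : rel T) : Prop :=
  exists c : T -> 'I_t,
    complete_partite e c /\
    forall i : 'I_t,
      #|[set x | c x == i]| = (#|T| %/ t)%N \/
      #|[set x | c x == i]| = ceil_div #|T| t.

(* Main.v *)
(* For a vector x and a number b, consider
     F_b(G, x) = sum over edges uv of (x_u + x_v)^2 - b sum_v x_v^2.
   Zykov symmetrization works for F_b if the values of x are copied together
   with the neighbourhoods: let u maximise the local contribution
   h(v) = sum over neighbours y of v of (x_v + x_y)^2 - b x_v^2 and replace every
   non-neighbour of u by a copy of u. Then F_b does not decrease, and induction
   inside the neighbourhood of u gives a complete w-partite graph H and a vector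
   z with F_b(G, x) <= F_b(H, z); for x > 0 the inequality can be made strict
   unless G is itself complete w-partite.
   If H has parts of sizes s_i, W is the sum of s_i / (b - n + 2 s_i) and S the
   sum of the z_v, then F_b(H, z) <= S^2 (W - 1), by tangent-line bounds for
   squares. When b is the Turan bound, s / (b - n + 2 s) is concave in s and
   W = 1 for balanced parts, so W <= 1 always; for w >= 3 equality forces
   balanced parts, and for w = 2 any two nonempty parts give W = 1, as b = n.
   Hence F_b(G, .) <= 0. If v is an eigenvector for q_1 then
   F_b(G, |v|) >= (q_1 - b) |v|^2, so q_1 <= b; if q_1 = b then |v| maximises
   F_b, so it is an eigenvector, positive by connectedness, and the strict form
   applies. *)

Require Import Defs.
From HB Require Import structures.
From mathcomp Require Import all_boot all_order all_algebra.
From mathcomp Require Import all_classical all_reals.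
From mathcomp Require Import ring lra zify.

Set Implicit Arguments.
Unset Strict Implicit.
Unset Printing Implicit Defensive.

Import Order.TTheory GRing.Theory Num.Theory.

Local Open Scope ring_scope.

(** * Zykov symmetrization of weighted edge energies *)

Section Symmetrization.
Variables (R : realFieldType) (T : finType) (kappa : R -> R -> R).
Hypothesis kappaC : forall s t, kappa s t = kappa t s.

(* Sums over ordered pairs: each edge counts twice. *)
Definition energy (phi : R -> R) (A : {set T}) (e : rel T) (x : T -> R) : R :=
  \sum_(a in A) \sum_(b in A) (e a b)%:R * kappa (x a) (x b)
  + \sum_(a in A) phi (x a).

(** The terms of [energy] that involve [a] when [e] is symmetric and irreflexive: each edge at [a]
    occurs twice among them, hence the factor 2. *)
Definition local_energy (phi : R -> R) (A : {set T}) (e : rel T) (x : T -> R)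
    (a : T) : R :=
  2 * \sum_(b in A) (e a b)%:R * kappa (x a) (x b) + phi (x a).

(** Colours are natural numbers, so that the induction on the number of parts adds a colour without
    casts. *)
Definition partite_rel (c : T -> nat) : rel T := fun a b => c a != c b.

Lemma sum_setID (A : {set T}) (p : pred T) (F : T -> R) :
  \sum_(a in A) F a =
  \sum_(a in [set a in A | p a]) F a + \sum_(a in [set a in A | ~~ p a]) F a.
Proof.
rewrite (bigID p) /=; congr (_ + _); apply: eq_bigl => a; by rewrite inE.
Qed.

Lemma energy_split phi (A : {set T}) (p : pred T) (e : rel T) (x : T -> R) :
    symmetric e ->
  let A' := [set a in A | p a] in let B := [set a in A | ~~ p a] in
  energy phi A e x = energy phi A' e x
    + 2 * (\sum_(b in B) \sum_(a in A') (e b a)%:R * kappa (x b) (x a))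
    + \sum_(a in B) \sum_(b in B) (e a b)%:R * kappa (x a) (x b)
    + \sum_(b in B) phi (x b).
Proof.
move=> e_sym A' B; rewrite /energy (sum_setID A p (fun a => phi (x a))).
have sumA (C : {set T}) : \sum_(a in C) \sum_(b in A) (e a b)%:R * kappa (x a) (x b) =
    \sum_(a in C) \sum_(b in A') (e a b)%:R * kappa (x a) (x b)
    + \sum_(a in C) \sum_(b in B) (e a b)%:R * kappa (x a) (x b).
  by rewrite -big_split; apply: eq_bigr => a _; rewrite (sum_setID A p).
rewrite (sum_setID A p) -/A' -/B !sumA.
have -> : \sum_(a in A') \sum_(b in B) (e a b)%:R * kappa (x a) (x b) =
    \sum_(b in B) \sum_(a in A') (e b a)%:R * kappa (x b) (x a).
  rewrite exchange_big; apply: eq_bigr => b _; apply: eq_bigr => a _.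
  by rewrite e_sym kappaC.
ring.
Qed.

(* Every non-neighbour of [u] is replaced by a copy of [u] carrying the value
   [x u]; the potential [phi'] records the edges from these copies to the
   neighbours of [u]. *)
Lemma symmetrize_step phi (A : {set T}) (e : rel T) (x z' : T -> R)
    (c' : T -> nat) (t : nat) (u : T) :
    symmetric e -> irreflexive e -> u \in A ->
  let A' := [set a in A | e u a] in let B := [set a in A | ~~ e u a] in
  let phi' s := phi s + 2 * #|B|%:R * kappa (x u) s in
  {in A', forall a, (c' a < t)%N} ->
  exists (c : T -> nat) (z : T -> R), [/\ {in A, forall a, (c a < t.+1)%N},
    {in A', c =1 c'}, {in B, forall b, c b = t} &
    energy phi A (partite_rel c) z - energy phi A e x =
    (energy phi' A' (partite_rel c') z' - energy phi' A' e x)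
    + \sum_(b in B) (local_energy phi A e x u - local_energy phi A e x b)
    + \sum_(a in B) \sum_(b in B) (e a b)%:R * kappa (x a) (x b)].
Proof.
move=> e_sym e_irr uA A' B phi' c'lt.
pose c a := if e u a then c' a else t.
pose z a := if e u a then z' a else x u.
have A'E a : a \in A' -> e u a by rewrite inE => /andP[].
have BE a : a \in B -> e u a = false by rewrite inE => /andP[_ /negPf].
exists c, z; split.
- move=> a aA; rewrite /c; case: ifP => // ua.
  by rewrite ltnS ltnW// c'lt// inE aA.
- by move=> a /A'E; rewrite /c => ->.
- by move=> a /BE; rewrite /c => ->.
rewrite (@energy_split _ _ (e u) (partite_rel c)); last first.
  by move=> a b; rewrite /partite_rel eq_sym.
rewrite (@energy_split _ _ (e u) e)// -/A' -/B.
have -> : energy phi A' (partite_rel c) z = energy phi A' (partite_rel c') z'.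
  rewrite /energy; congr (_ + _); last first.
    by apply: eq_bigr => a /A'E; rewrite /z => ->.
  apply: eq_bigr => a /A'E ua; apply: eq_bigr => b /A'E ub.
  by rewrite /partite_rel /z /c ua ub.
have -> : \sum_(a in B) \sum_(b in B)
    (partite_rel c a b)%:R * kappa (z a) (z b) = 0.
  apply: big1 => a /BE ua; apply: big1 => b /BE ub.
  by rewrite /partite_rel /c ua ub eqxx mul0r.
have -> : \sum_(b in B) phi (z b) = #|B|%:R * phi (x u).
  under eq_bigr => b /BE ub do rewrite /z ub.
  by rewrite sumr_const mulr_natl.
have -> : \sum_(b in B) \sum_(a in A')
    (partite_rel c b a)%:R * kappa (z b) (z a) =
    #|B|%:R * \sum_(a in A') kappa (x u) (z' a).
  under eq_bigr => b /BE ub.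
    under eq_bigr => a aA'.
      have ua := A'E a aA'.
      rewrite /partite_rel /z /c ua ub.
      have -> : (t != c' a) by rewrite neq_ltn c'lt// orbT.
      rewrite mul1r; over.
    over.
  by rewrite sumr_const mulr_natl.
rewrite big_split /= sumr_const -mulr_natl sumrN.
have -> : local_energy phi A e x u =
    2 * \sum_(a in A') kappa (x u) (x a) + phi (x u).
  rewrite /local_energy (sum_setID A (e u)) -/A' -/B.
  rewrite [X in 2 * (_ + X)]big1 ?addr0; last by move=> b /BE->; rewrite mul0r.
  by congr (2 * _ + _); apply: eq_bigr => b /A'E->; rewrite mul1r.
(* Ordered pairs inside [B] get coefficient 2 here but 1 in [energy]; the difference is the last sum
   of the identity. *)
have -> : \sum_(b in B) local_energy phi A e x b =
    2 * (\sum_(b in B) \sum_(a in A') (e b a)%:R * kappa (x b) (x a))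
    + 2 * (\sum_(a in B) \sum_(b in B) (e a b)%:R * kappa (x a) (x b))
    + \sum_(b in B) phi (x b).
  rewrite /local_energy big_split /= -mulr_sumr -mulrDr -big_split; congr (2 * _ + _).
  by apply: eq_bigr => b _; rewrite (sum_setID A (e u)).
have phi'E f g : energy phi' A' f g = energy phi A' f g
    + 2 * #|B|%:R * \sum_(a in A') kappa (x u) (g a).
  by rewrite /energy big_split /= -mulr_sumr addrA.
rewrite !phi'E; ring.
Qed.

(** Relative to a set [A], because the induction descends into neighbourhoods. *)
Definition clique_bounded (e : rel T) (A : {set T}) (t : nat) : Prop :=
  forall K : {set T}, clique e K -> K \subset A -> (#|K| <= t)%N.

Lemma clique_bounded0 (e : rel T) (A : {set T}) :
  clique_bounded e A 0 -> A = finset.set0.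
Proof.
move=> At; apply/setP => a; rewrite inE; apply/negP => aA.
have := At [set a]; rewrite cards1 finset.sub1set aA => /(_ _ isT).
suff -> : clique e [set a] by move=> /(_ isT).
by apply/forall_inP => x /set1P->; apply/forall_inP => y /set1P->; rewrite eqxx.
Qed.

Lemma clique_bounded_nbhd (e : rel T) (A : {set T}) (t : nat) (u : T) :
    symmetric e -> irreflexive e -> u \in A ->
  clique_bounded e A t.+1 -> clique_bounded e [set a in A | e u a] t.
Proof.
move=> e_sym e_irr uA At K /forall_inP Kc KA.
have uK : u \notin K.
  by apply/negP => /(fintype.subsetP KA); rewrite inE e_irr andbF.
have := At (u |: K); rewrite cardsU1 uK add1n ltnS; apply; last first.
  rewrite finset.subUset finset.sub1set uA; apply: fintype.subset_trans KA _.
  by apply/fintype.subsetP => a; rewrite inE => /andP[].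
have eK a : a \in K -> e u a by move=> /(fintype.subsetP KA); rewrite inE => /andP[].
apply/forall_inP => a /setU1P[->|aK]; apply/forall_inP => b /setU1P[->|bK].
- by rewrite eqxx.
- by rewrite eK ?implybT.
- by rewrite e_sym eK ?implybT.
- by have /forall_inP/(_ _ bK) := Kc _ aK.
Qed.

Lemma exists_max (A : {set T}) (h : T -> R) : A != finset.set0 ->
  exists2 u, u \in A & {in A, forall v, h v <= h u}.
Proof.
move=> /set0Pn[a aA].
by case: (@Order.TotalTheory.arg_maxP _ _ _ a (mem A) h aA) => u uA hu; exists u.
Qed.

(** Induction on [t] with [phi] and [A] general, since passing to the neighbourhood of a maximiser
    of the local energy replaces the potential by [phi']. All three terms of the identity in
    [symmetrize_step] are then nonnegative. *)
Lemma turan_energy_le phi (A : {set T}) (e : rel T) (x : T -> R) (t : nat) :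
    symmetric e -> irreflexive e -> (forall a b, 0 <= kappa (x a) (x b)) ->
    clique_bounded e A t ->
  exists (c : T -> nat) (z : T -> R), {in A, forall a, (c a < t)%N} /\
    energy phi A e x <= energy phi A (partite_rel c) z.
Proof.
move=> e_sym e_irr k_ge0; elim: t phi A => [|t IH] phi A At.
  exists (fun=> 0%N), x; rewrite (clique_bounded0 At); split.
    by move=> a; rewrite inE.
  by rewrite /energy !big_set0.
have [->|A0] := eqVneq A finset.set0.
  exists (fun=> 0%N), x; split; first by move=> a; rewrite inE.
  by rewrite /energy !big_set0.
have [u uA umax] := exists_max (local_energy phi A e x) A0.
set phi' := fun s => phi s + 2 * #|[set a in A | ~~ e u a]|%:R * kappa (x u) s.
have [c' [z' [c'lt le']]] := IH phi' _ (clique_bounded_nbhd e_sym e_irr uA At).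
have [c [z [clt _ _ E]]] :=
  symmetrize_step phi x z' e_sym e_irr uA c'lt.
exists c, z; split=> //; rewrite -subr_ge0 E -addrA.
apply: addr_ge0; first by rewrite subr_ge0.
apply: addr_ge0; last by do 2![apply: sumr_ge0 => *]; rewrite mulr_ge0.
by apply: sumr_ge0 => b; rewrite inE => /andP[bA _]; rewrite subr_ge0 umax.
Qed.

(** When no term of the identity in [symmetrize_step] is positive, the non-neighbours of a maximiser
    are maximisers and pairwise non-adjacent; they form one part, joined to everything else in
    [A]. *)
Lemma turan_energy_lt phi (A : {set T}) (e : rel T) (x : T -> R) (t : nat) :
    symmetric e -> irreflexive e -> (forall a b, 0 < kappa (x a) (x b)) ->
    clique_bounded e A t ->
  exists c : T -> nat, {in A, forall a, (c a < t)%N} /\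
    ((exists z, energy phi A e x < energy phi A (partite_rel c) z) \/
     {in A &, e =2 partite_rel c}).
Proof.
move=> e_sym e_irr k_gt0; elim: t phi A => [|t IH] phi A At.
  exists (fun=> 0%N); rewrite (clique_bounded0 At).
  by split=> [a|]; [|right=> a b]; rewrite inE.
have [->|A0] := eqVneq A finset.set0.
  exists (fun=> 0%N); by split=> [a|]; [|right=> a b]; rewrite inE.
have ek_ge0 a b : 0 <= (e a b)%:R * kappa (x a) (x b).
  by rewrite mulr_ge0// ltW.
pose B v := [set a in A | ~~ e v a].
pose maxi v := {in A, forall a, local_energy phi A e x a <= local_energy phi A e x v}.
pose phi' v s := phi s + 2 * #|B v|%:R * kappa (x v) s.
(* A drop of the local energy inside [B v], or an edge inside it, makes one of the last two terms of
   the identity positive; the first is nonnegative by [turan_energy_le]. *)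
have strict v : v \in A -> maxi v ->
    (exists a, a \in B v /\ local_energy phi A e x a < local_energy phi A e x v) \/
    (exists a b, [/\ a \in B v, b \in B v & e a b]) ->
  exists c : T -> nat, {in A, forall a, (c a < t.+1)%N} /\
    exists z, energy phi A e x < energy phi A (partite_rel c) z.
  move=> vA vmax H.
  have [c' [z' [c'lt le']]] := turan_energy_le (phi' v) e_sym e_irr
    (fun a b => ltW (k_gt0 a b)) (clique_bounded_nbhd e_sym e_irr vA At).
  have [c [z [clt _ _ E]]] := symmetrize_step phi x z' e_sym e_irr vA c'lt.
  exists c; split=> //; exists z; rewrite -subr_gt0 E -/(B v) -addrA.
  rewrite ltr_wpDl ?subr_ge0//.
  have h1_ge0 b : b \in B v -> 0 <= local_energy phi A e x v - local_energy phi A e x b.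
    by rewrite inE => /andP[bA _]; rewrite subr_ge0 vmax.
  case: H => [[a [aB lta]]|[a [b [aB bB ab]]]].
    rewrite ltr_pwDl//; last by do 2![apply: sumr_ge0 => *].
    rewrite (bigD1 a) //= ltr_pwDl ?subr_gt0//.
    by apply: sumr_ge0 => b /andP[bB _]; exact: h1_ge0.
  rewrite ltr_wpDl//; first by apply: sumr_ge0.
  rewrite (bigD1 a) //= ltr_pwDl//; last by do 2![apply: sumr_ge0 => *].
  rewrite (bigD1 b) //= ltr_pwDl//; last by apply: sumr_ge0.
  by rewrite ab mul1r.
have [u uA umax] := exists_max (local_energy phi A e x) A0.
have [c' [c'lt H']] := IH (phi' u) _ (clique_bounded_nbhd e_sym e_irr uA At).
case: H' => [[z' lt']|eq'].
  have [c [z [clt _ _ E]]] := symmetrize_step phi x z' e_sym e_irr uA c'lt.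
  exists c; split=> //; left; exists z; rewrite -subr_gt0 E -addrA.
  rewrite ltr_pwDl ?subr_gt0// addr_ge0//.
    by apply: sumr_ge0 => b; rewrite inE => /andP[bA _]; rewrite subr_ge0 umax.
  by do 2![apply: sumr_ge0 => *].
have [S|nS] := pselect (exists v, [/\ v \in A, maxi v &
    (exists a, a \in B v /\ local_energy phi A e x a < local_energy phi A e x v) \/
    (exists a b, [/\ a \in B v, b \in B v & e a b])]).
  case: S => v [vA vmax /(strict v vA vmax)[c [clt lt]]].
  by exists c; split=> //; left.
have Bmax v a : v \in A -> maxi v -> a \in B v -> maxi a.
  move=> vA vmax aB b bA; apply: le_trans (vmax b bA) _.
  rewrite leNgt; apply/negP => lt; apply: nS; exists v; split=> //.
  by left; exists a.
have Bind v a b : v \in A -> maxi v -> a \in B v -> b \in B v -> e a b = false.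
  move=> vA vmax aB bB; apply/negP => ab; apply: nS; exists v; split=> //.
  by right; exists a, b.
(* Non-neighbours of [u] are themselves maximisers, so their non-neighbourhoods
   are independent too: non-adjacency to [u] is transitive. *)
have join a b : a \in B u -> b \in A -> e u b -> e a b.
  move=> aB bA ub; have aA : a \in A by move: aB; rewrite inE => /andP[].
  apply/negPn/negP => nab.
  have : e u b = false.
    apply: (Bind a) => //; first exact: (Bmax u).
    - by rewrite inE uA e_sym; move: aB; rewrite inE => /andP[].
    - by rewrite inE bA.
  by rewrite ub.
(* Only the colouring [c] matters here, so [x] itself serves as the vector on the neighbourhood. *)
have [c [z [clt cA' cB _]]] := symmetrize_step phi x x e_sym e_irr uA c'lt.
exists c; split=> //; right=> a b aA bA; rewrite /partite_rel.
have inA' d : d \in A -> e u d -> d \in [set a in A | e u a].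
  by move=> dA ud; rewrite inE dA.
have inB d : d \in A -> ~~ e u d -> d \in B u by move=> dA ud; rewrite inE dA.
have [ua|/inB ua] := boolP (e u a); have [ub|/inB ub] := boolP (e u b).
- by rewrite !cA' ?inA'// eq' ?inA'.
- rewrite e_sym (join b a) ?ub// cA' ?inA'// cB ?ub//.
  by rewrite neq_ltn c'lt// inA'.
- rewrite (join a b) ?ua// (cA' b) ?inA'// cB ?ua//.
  by rewrite neq_ltn c'lt ?orbT// inA'.
- by rewrite (Bind u) ?ua ?ub// !cB ?ua ?ub// eqxx.
Qed.

End Symmetrization.

(** * Energy of complete partite graphs and sums of part weights *)

Section PartiteForm.
Variables (R : realFieldType) (T : finType).

Definition sq_kappa (s t : R) : R := (s + t) ^+ 2.

(* An empty part has weight [0], also when [m = 0] (division by zero). *)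
Definition part_weight (m : R) (s : nat) : R := s%:R / (m + 2 * s%:R).

Lemma sum_sqD (P : pred T) (z : T -> R) :
  \sum_(a | P a) \sum_(b | P b) (z a + z b) ^+ 2 =
  2 * #|[set a | P a]|%:R * \sum_(a | P a) z a ^+ 2 + 2 * (\sum_(a | P a) z a) ^+ 2.
Proof.
rewrite cardsE.
have rowE a : \sum_(b | P b) (z a + z b) ^+ 2 =
    #|P|%:R * z a ^+ 2 + 2 * z a * (\sum_(b | P b) z b) + \sum_(b | P b) z b ^+ 2.
  rewrite mulr_natl -sumr_const mulr_sumr -!big_split /=.
  by apply: eq_bigr => b _; ring.
under eq_bigr do rewrite rowE.
rewrite !big_split /= -mulr_sumr -mulr_suml -mulr_sumr sumr_const -mulr_natl.
ring.
Qed.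

Lemma sum_partite (w : nat) (c : T -> 'I_w) (F : T -> T -> R) :
  \sum_a \sum_b (c a != c b)%:R * F a b =
  \sum_a \sum_b F a b - \sum_i \sum_(a | c a == i) \sum_(b | c b == i) F a b.
Proof.
rewrite [X in _ = _ - X](_ : _ = \sum_a \sum_(b | c b == c a) F a b).
  rewrite -sumrB; apply: eq_bigr => a _.
  rewrite [X in _ = X - _](bigID (fun b => c b == c a)) /= addrAC subrr add0r.
  rewrite [RHS]big_mkcond; apply: eq_bigr => b _; rewrite eq_sym.
  by case: eqP; rewrite ?mul0r ?mul1r.
rewrite [RHS](partition_big c xpredT) //=; apply: eq_bigr => i _.
by apply: eq_bigr => a /eqP->.
Qed.

Lemma partite_energy_le (w : nat) (c : T -> 'I_w) (m : R) (z : T -> R) :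
    0 <= m ->
  energy sq_kappa (fun s => - (2 * (#|T|%:R + m) * s ^+ 2)) [set: T] (partite_rel c) z
  <= 2 * (\sum_a z a) ^+ 2 *
     (\sum_i part_weight m #|[set a | c a == i]| - 1).
Proof.
move=> m_ge0; rewrite /energy; under eq_bigl do rewrite inE.
under eq_bigr do under eq_bigl do rewrite inE.
under [X in _ + X]eq_bigl do rewrite inE.
rewrite /partite_rel /= (sum_partite c (fun a b => sq_kappa (z a) (z b))) /sq_kappa.
rewrite sum_sqD sumrN -mulr_sumr.
under [X in _ - X - _]eq_bigr do rewrite sum_sqD.
set S := \sum_a z a.
have SE : S = \sum_i \sum_(a | c a == i) z a.
  by rewrite /S (partition_big c xpredT).
have NE : \sum_a z a ^+ 2 = \sum_i \sum_(a | c a == i) z a ^+ 2.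
  by rewrite (partition_big c xpredT).
(* The energy expands to 2 (S ^ 2 - the sum of these right-hand sides). On a nonempty part the bound
   is the tangent at the constant vector with value S / (m + 2 s). *)
have class_le i : 2 * S * (\sum_(a | c a == i) z a)
      - S ^+ 2 * part_weight m #|[set a | c a == i]|
    <= m * (\sum_(a | c a == i) z a ^+ 2) +
       #|[set a | c a == i]|%:R * (\sum_(a | c a == i) z a ^+ 2)
       + (\sum_(a | c a == i) z a) ^+ 2.
  set s := #|_|%:R.
  set N := \sum_(a | _) _ ^+ 2; set Z := \sum_(a | _) _.
  have [s0|s_gt0] := posnP #|[set a | c a == i]|.
    have P0 a : (c a == i) = false by have := card0_eq s0 a; rewrite inE.
    rewrite /part_weight /s s0 /Z /N !big_pred0 //.
    by rewrite !mul0r !mulr0 expr0n /= !addr0 subr0.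
  have s_pos : 0 < s by rewrite /s ltr0n.
  have d_pos : 0 < m + 2 * s by lra.
  set p := (m + 2 * s)^-1.
  have dp : (m + 2 * s) * p = 1 by rewrite mulfV// gt_eqF.
  rewrite /part_weight -/s -/p.
  have : 0 <= \sum_(a | c a == i) (z a - S * p) ^+ 2.
    by apply: sumr_ge0 => a _; exact: sqr_ge0.
  have -> : \sum_(a | c a == i) (z a - S * p) ^+ 2 = N - 2 * (S * p) * Z + s * (S * p) ^+ 2.
    have -> : s * (S * p) ^+ 2 = \sum_(a | c a == i) (S * p) ^+ 2.
      by rewrite sumr_const /s cardsE mulr_natl.
    rewrite /N /Z mulr_sumr -sumrB -big_split /=.
    by apply: eq_bigr => a _; ring.
  move=> N_ge; have h1 := mulr_ge0 (addr_ge0 m_ge0 (ltW s_pos)) N_ge.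
  have h2 := sqr_ge0 (Z - s * (S * p)).
  rewrite -subr_ge0.
  (* The last summand is zero by [dp]; including it makes the identity polynomial, within reach of
     [ring]. *)
  have -> : m * N + s * N + Z ^+ 2 - (2 * S * Z - S ^+ 2 * (s * p)) =
     (m + s) * (N - 2 * (S * p) * Z + s * (S * p) ^+ 2) + (Z - s * (S * p)) ^+ 2
     + (2 * S * Z - S ^+ 2 * s * p) * ((m + 2 * s) * p - 1) by ring.
  by rewrite dp subrr mulr0 addr0 addr_ge0.
have := ler_sum (index_enum 'I_w) (P := xpredT) (fun i _ => class_le i).
rewrite sumrB -!mulr_sumr -SE !big_split /= -!mulr_sumr -NE.
have -> : \sum_i (2 * #|[set a | c a == i]|%:R * (\sum_(a | c a == i) z a ^+ 2)) =
  2 * \sum_i #|[set a | c a == i]|%:R * (\sum_(a | c a == i) z a ^+ 2).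
  by rewrite mulr_sumr; apply: eq_bigr => i _; rewrite mulrA.
have -> : #|[set _ : T | true]| = #|T| by rewrite cardsE.
nra.
Qed.

(** The chord of the concave weight through [k] and [k.+1], with its exact remainder. The product of
    consecutive integers gives the sign, and for [0 < m] the remainder vanishes only at the two
    nodes. The last hypothesis keeps the denominator at [s] nonzero. *)
Lemma part_weight_line (m : R) (k s : nat) : 0 <= m -> (0 < k)%N -> (0 < m) || (0 < s)%N ->
  part_weight m s = part_weight m k
    + (s%:R - k%:R) * (part_weight m k.+1 - part_weight m k)
    - 2 * m * ((s%:R - k%:R) * (s%:R - k%:R - 1))
      / ((m + 2 * s%:R) * (m + 2 * k%:R) * (m + 2 * k.+1%:R)).
Proof.
move=> m_ge0 k_gt0 ms; have k_pos : 0 < k%:R :> R by rewrite ltr0n.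
have s_pos : 0 < m + 2 * s%:R.
  have := ler0n R s; case/orP: ms => [|s_gt0]; first by lra.
  by have : 0 < s%:R :> R; [rewrite ltr0n|lra].
rewrite /part_weight -[k.+1%:R]natr1; field.
by rewrite !gt_eqF//; lra.
Qed.

Lemma consecutive_mul_ge0 (k s : nat) :
  0 <= (s%:R - k%:R) * (s%:R - k%:R - 1) :> R.
Proof.
have [|] := leqP s k; rewrite -(ler_nat R) -?natr1 => ?.
  by rewrite -mulrNN mulr_ge0//; lra.
by rewrite mulr_ge0//; lra.
Qed.

Lemma part_weight_le (m : R) (k s : nat) : 0 <= m -> (0 < k)%N ->
  part_weight m s <= part_weight m k
    + (s%:R - k%:R) * (part_weight m k.+1 - part_weight m k).
Proof.
move=> m_ge0 k_gt0; have [ms|] := boolP ((0 < m) || (0 < s)%N).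
  rewrite (part_weight_line m_ge0 k_gt0 ms) gerBl; apply: divr_ge0.
    by rewrite mulr_ge0 ?consecutive_mul_ge0// mulr_ge0.
  by rewrite !mulr_ge0// addr_ge0// mulr_ge0.
(* Left over is [m = 0] with an empty part: the chord is constantly 1/2 and the weight is 0. *)
rewrite negb_or -leqNgt leqn0 -leNgt => /andP[m_le0 /eqP->].
have -> : m = 0 by apply/eqP; rewrite eq_le m_le0.
have k_neq0 : k%:R != 0 :> R by rewrite pnatr_eq0 -lt0n.
have k1_neq0 : k%:R + 1 != 0 :> R by rewrite natr1 pnatr_eq0.
rewrite /part_weight -[k.+1%:R]natr1 !add0r mulr0 mul0r.
have -> : k%:R / (2 * k%:R) = 2^-1 :> R by field.
have -> : (k%:R + 1) / (2 * (k%:R + 1)) = 2^-1 :> R by field.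
by rewrite subrr mulr0 addr0 invr_ge0.
Qed.

(** The chord is affine in the part sizes, so its sum depends only on their total and equals the
    balanced value. *)
Lemma sum_line (w k r : nat) (s : 'I_w -> nat) (g d : R) :
    (\sum_i s i = k * w + r)%N ->
  \sum_i (g + ((s i)%:R - k%:R) * d) = w%:R * g + r%:R * d.
Proof.
move=> sum_s; rewrite big_split /= -mulr_suml sumrB !sumr_const !card_ord.
rewrite -natr_sum sum_s natrD natrM -(mulr_natl g) -(mulr_natl k%:R); ring.
Qed.

Lemma sum_part_weight_le (w k r : nat) (s : 'I_w -> nat) (m : R) :
    0 <= m -> (0 < k)%N -> (\sum_i s i = k * w + r)%N ->
  \sum_i part_weight m (s i)
  <= r%:R * part_weight m k.+1 + (w%:R - r%:R) * part_weight m k.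
Proof.
move=> m_ge0 k_gt0 sum_s.
apply: le_trans (ler_sum _ (fun i _ => part_weight_le (s i) m_ge0 k_gt0)) _.
by rewrite (sum_line _ _ sum_s) le_eqVlt; apply/orP; left; apply/eqP; ring.
Qed.

(** The slacks in the chord bound are nonnegative and sum to at most 0, so every remainder
    vanishes. *)
Lemma sum_part_weight_eq (w k r : nat) (s : 'I_w -> nat) (m : R) :
    0 < m -> (0 < k)%N -> (\sum_i s i = k * w + r)%N ->
    r%:R * part_weight m k.+1 + (w%:R - r%:R) * part_weight m k
    <= \sum_i part_weight m (s i) ->
  forall i, s i = k \/ s i = k.+1.
Proof.
move=> m_gt0 k_gt0 sum_s ge i; have m_ge0 := ltW m_gt0.
have le j := part_weight_le (s j) m_ge0 k_gt0.
have /eqP : \sum_j (part_weight m k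
    + ((s j)%:R - k%:R) * (part_weight m k.+1 - part_weight m k)
    - part_weight m (s j)) = 0.
  apply/eqP; rewrite eq_le; apply/andP; split.
    rewrite sumrB (sum_line _ _ sum_s) subr_le0; apply: le_trans ge.
    by rewrite le_eqVlt; apply/orP; left; apply/eqP; ring.
  by apply: sumr_ge0 => j _; rewrite subr_ge0.
rewrite psumr_eq0; last by move=> j _; rewrite subr_ge0.
move=> /allP/(_ i (mem_index_enum i)) /=.
rewrite {1}(part_weight_line (s := s i) m_ge0 k_gt0) ?m_gt0// opprB addrC addrNK.
have p1 n : m + 2 * n%:R != 0 by rewrite gt_eqF// ltr_wpDr// mulr_ge0.
rewrite !mulf_eq0 !invr_eq0 !mulf_eq0 !(negPf (p1 _)) /= !orbF pnatr_eq0 /=.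
rewrite (gt_eqF m_gt0) /= -subr_eq0 subr0 subr_eq0 eqr_nat.
case/orP => [/eqP->|]; first by left.
by rewrite subr_eq0 subr_eq addrC natr1 eqr_nat => /eqP->; right.
Qed.

Lemma sum_part_weight_balanced (w k r : nat) (s : 'I_w -> nat) (m : R) :
    0 <= m -> (0 < k)%N -> (\sum_i s i = k * w + r)%N ->
    (forall i, s i = k \/ s i = k.+1) ->
  \sum_i part_weight m (s i) =
  r%:R * part_weight m k.+1 + (w%:R - r%:R) * part_weight m k.
Proof.
move=> m_ge0 k_gt0 sum_s sP.
rewrite (eq_bigr (fun i => part_weight m k
    + ((s i)%:R - k%:R) * (part_weight m k.+1 - part_weight m k))).
  by rewrite (sum_line _ _ sum_s); ring.
by move=> i _; case: (sP i) => ->; rewrite -?natr1; ring.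
Qed.

End PartiteForm.

(** * The bound as the root of a quadratic equation *)

Definition turan_bound (R : rcfType) (w k r : nat) : R :=
  ((3 * w%:R - 4) * k%:R + 3 * r%:R - 2
   + Num.sqrt (k%:R ^+ 2 * w%:R ^+ 2
               + ((2 * r%:R + 4) * w%:R - 8 * r%:R) * k%:R
               + (r%:R - 2) ^+ 2)) / 2.

(* With [u = turan_bound - n + 2 k], the bound is the positive root of
   [u ^ 2 + (2 - n) u - 2 (w - r) k = 0]. *)
Lemma turan_bound_spec (R : rcfType) (w k r : nat) :
    (2 <= w)%N -> (0 < k)%N -> (r < w)%N ->
  let m := turan_bound R w k r - (k * w + r)%:R in
  [/\ 0 <= m, (2 < w)%N -> 0 < m, w = 2%N -> m = 0 &
    r%:R * part_weight m k.+1 + (w%:R - r%:R) * part_weight m k = 1].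
Proof.
move=> w_ge2 k_gt0 r_lt m.
have w2 : 2 <= w%:R :> R by rewrite (ler_nat R 2 w).
have k1 : 1 <= k%:R :> R by rewrite (ler_nat R 1 k).
have r0 : 0 <= r%:R :> R by [].
have rw : r%:R + 1 <= w%:R :> R by rewrite natr1 ler_nat.
have w3 : (2 < w)%N -> 3 <= w%:R :> R by move=> ?; rewrite (ler_nat R 3 w).
have weq : w = 2%N -> w%:R = 2 :> R by move->.
have r1 : w = 2%N -> r%:R <= 1 :> R by move=> /weq ?; lra.
move: @m; rewrite /turan_bound /part_weight natrD natrM -[k.+1%:R]natr1.
move: (w%:R : R) (k%:R : R) (r%:R : R) w2 k1 r0 rw w3 weq r1 => W K P w2 k1 r0 rw w3 weq r1.
set D := (X in Num.sqrt X).
(* Two completions of the square: [DE] gives positivity and the quadratic equation, [D2] compares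
   the square root with [4 * K + 2 - (K * W + P)], from which it differs by [2 * m]. *)
have DE : D = (K * W + P - 2) ^+ 2 + 8 * (W - P) * K by rewrite /D; ring.
have D2 : D = (4 * K + 2 - (K * W + P)) ^+ 2 + 8 * K * (K + 1) * (W - 2).
  by rewrite /D; ring.
have D_gt0 : 0 < D.
  rewrite DE ltr_wpDl ?sqr_ge0// mulr_gt0 ?mulr_gt0//; lra.
have d_gt0 : 0 < Num.sqrt D by rewrite sqrtr_gt0.
have dd : Num.sqrt D ^+ 2 = D by rewrite sqr_sqrtr// ltW.
move: (Num.sqrt D) d_gt0 dd => d d_gt0 dd.
set m := (_ / 2 - (K * W + P)).
have KW : 2 * K <= K * W by nra.
have mE : 2 * m = d - (4 * K + 2 - (K * W + P)) by rewrite /m; field.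
have tail_ge0 : 0 <= 8 * K * (K + 1) * (W - 2).
  by rewrite !mulr_ge0//; lra.
have m_ge0 : 0 <= m.
  have : 4 * K + 2 - (K * W + P) <= d; last by lra.
  by rewrite leNgt; apply/negP => lt; nra.
split=> //.
- move=> /w3 W3; have tail_gt0 : 0 < 8 * K * (K + 1) * (W - 2).
    by rewrite !mulr_gt0//; lra.
  have : 4 * K + 2 - (K * W + P) < d; last by lra.
  by rewrite ltNge; apply/negP => lt; nra.
(* For [w = 2] the tail in [D2] vanishes, and positivity of [d] selects [d = 2 * K + 2 - P], that is
   [m = 0]. *)
- move=> w2E; have WE := weq w2E; have P1 := r1 w2E; subst W.
  have : d ^+ 2 = (2 * K + 2 - P) ^+ 2 by rewrite dd D2; ring.
  move/eqP; rewrite eqf_sqr => /orP[]/eqP; lra.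
have u_gt0 : 0 < m + 2 * K by lra.
have root : (m + 2 * K) ^+ 2 + (2 - (K * W + P)) * (m + 2 * K) = 2 * (W - P) * K.
  have -> : m = (d - (4 * K + 2 - (K * W + P))) / 2 by lra.
  have : d ^+ 2 = (K * W + P - 2) ^+ 2 + 8 * (W - P) * K by rewrite dd.
  lra.
have u1 : m + 2 * K != 0 by rewrite gt_eqF.
have u2 : m + 2 * (K + 1) != 0 by rewrite gt_eqF//; lra.
apply: (mulIf (mulf_neq0 u1 u2)).
have -> : (P * ((K + 1) / (m + 2 * (K + 1))) + (W - P) * (K / (m + 2 * K)))
   * ((m + 2 * K) * (m + 2 * (K + 1))) =
   P * (K + 1) * (m + 2 * K) + (W - P) * K * (m + 2 * (K + 1)).
  by field; rewrite u1 u2.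
by move: root; lra.
Qed.

(** * Quadratic form and eigenvectors of the signless Laplacian *)

Section SignlessLaplacian.
Variables (R : realType) (T : finType) (e : rel T).
Hypothesis e_sym : symmetric e.

(** Trades row vectors indexed through [enum_val] for functions on vertices; symmetry of [e]
    accounts for the vector standing on the left. *)
Lemma eigenvalue_signlessP (a : R) :
  eigenvalue (signless_laplacian R e) a <->
  exists x : T -> R, (exists t, x t != 0) /\
    forall t, \sum_u (e t u)%:R * (x t + x u) = a * x t.
Proof.
have mulQ (x : T -> R) i :
    ((\row_j x (enum_val j)) *m signless_laplacian R e) 0 i =
    \sum_u (e (enum_val i) u)%:R * (x (enum_val i) + x u).
  rewrite mxE.
  under eq_bigr do rewrite !mxE mulrDr.
  under [RHS]eq_bigr do rewrite mulrDr.
  rewrite !big_split /=; congr (_ + _).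
    rewrite (bigD1 i)//= eqxx mulr1n big1 ?addr0; last first.
      by move=> j /negPf ji; rewrite ji mulr0n mulr0.
    rewrite -mulr_suml mulrC /degree; congr (_ * _).
    rewrite -sum1_card natr_sum big_mkcond /=; apply: eq_bigr => u _.
    by rewrite inE; case: (e _ _).
  rewrite [RHS](reindex (@enum_val T T)) /=; last exact/onW_bij/enum_val_bij.
  by apply: eq_bigr => j _; rewrite e_sym mulrC.
split=> [/eigenvalueP[v vQ v0]|[x [[t xt0] xE]]].
  exists (fun t => v 0 (enum_rank t)).
  have vE : v = \row_j v 0 (enum_rank (enum_val j)).
    by apply/rowP => j; rewrite mxE enum_valK.
  split.
    apply/existsP; apply: contraNT v0; rewrite negb_exists => /forallP v0.
    apply/eqP/rowP => j; rewrite [RHS]mxE; apply/eqP.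
    by have := v0 (enum_val j); rewrite enum_valK negbK.
  move=> t; have := mulQ (fun t => v 0 (enum_rank t)) (enum_rank t).
  by rewrite -vE vQ mxE enum_rankK => ->.
apply/eigenvalueP; exists (\row_j x (enum_val j)).
  by apply/rowP => i; rewrite mulQ xE !mxE.
apply: contra xt0 => /eqP/rowP/(_ (enum_rank t)).
by rewrite !mxE enum_rankK => ->.
Qed.

(** Twice F_b: ordered pairs count each edge twice, and the potential is doubled to match. *)
Definition q_energy (b : R) : rel T -> (T -> R) -> R :=
  energy (@sq_kappa R) (fun s => - (2 * b * s ^+ 2)) [set: T].

Lemma q_energyE b (g : rel T) x : q_energy b g x =
  \sum_t \sum_u (g t u)%:R * (x t + x u) ^+ 2 - 2 * b * \sum_t x t ^+ 2.
Proof.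
rewrite /q_energy /energy mulr_sumr -sumrN; congr (_ + _).
  by apply: eq_big => [t|t _]; rewrite ?inE//; apply: eq_bigl => u; rewrite inE.
by apply: eq_bigl => t; rewrite inE.
Qed.

(** The polarised edge form: exchanging the indices shows that the halves with [d t] and with [d u]
    agree. *)
Lemma polar_sum (x d : T -> R) :
  \sum_t \sum_u (e t u)%:R * ((x t + x u) * (d t + d u)) =
  2 * \sum_t d t * \sum_u (e t u)%:R * (x t + x u).
Proof.
have E1 : \sum_t \sum_u (e t u)%:R * ((x t + x u) * d t) =
    \sum_t d t * \sum_u (e t u)%:R * (x t + x u).
  by apply: eq_bigr => t _; rewrite mulr_sumr; apply: eq_bigr => u _; ring.
have E2 : \sum_t \sum_u (e t u)%:R * ((x t + x u) * d u) =
    \sum_t d t * \sum_u (e t u)%:R * (x t + x u).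
  rewrite exchange_big -E1; apply: eq_bigr => t _; apply: eq_bigr => u _.
  by rewrite e_sym (addrC (x u)).
rewrite mulr_natl mulr2n -{1}E1 -E2 -big_split; apply: eq_bigr => t _.
by rewrite -big_split; apply: eq_bigr => u _; rewrite /=; ring.
Qed.

Lemma eigen_q_energy (a : R) (x : T -> R) :
    (forall t, \sum_u (e t u)%:R * (x t + x u) = a * x t) ->
  q_energy a e x = 0.
Proof.
move=> xE; rewrite q_energyE; apply/eqP; rewrite subr_eq0; apply/eqP.
under eq_bigr do under eq_bigr do rewrite expr2.
rewrite (polar_sum x x) -mulrA; congr (2 * _); rewrite mulr_sumr.
by apply: eq_bigr => t _; rewrite xE; ring.
Qed.

(** The triangle inequality on each edge, while the sum of squares ignores signs. It is applied to
    eigenvectors for [a], where the first term vanishes. *)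
Lemma q_energy_norm_ge (a b : R) (x : T -> R) :
  q_energy a e x + 2 * (a - b) * \sum_t x t ^+ 2 <= q_energy b e (fun t => `|x t|).
Proof.
rewrite !q_energyE.
have -> : \sum_t `|x t| ^+ 2 = \sum_t x t ^+ 2.
  by apply: eq_bigr => t _; rewrite real_normK ?num_real.
have : \sum_t \sum_u (e t u)%:R * (x t + x u) ^+ 2 <=
    \sum_t \sum_u (e t u)%:R * (`|x t| + `|x u|) ^+ 2.
  apply: ler_sum => t _; apply: ler_sum => u _; apply: ler_wpM2l => //.
  rewrite -[X in X <= _]real_normK ?num_real//.
  by rewrite ler_pXn2r ?nnegrE ?addr_ge0// ler_normD.
lra.
Qed.

Lemma linear_coef_eq0 (L E : R) :
  (forall s, 2 * s * L + s ^+ 2 * E <= 0) -> L = 0.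
Proof.
move=> LE; have E_le0 : E <= 0.
  have := LE 1; have := LE (-1); lra.
have E1 : 0 < 1 - E by lra.
(* This value of [s] turns the left-hand side into a positive multiple of [L ^+ 2]. *)
have := LE (L / (1 - E)).
have -> : 2 * (L / (1 - E)) * L + (L / (1 - E)) ^+ 2 * E =
    L ^+ 2 * (2 - E) / (1 - E) ^+ 2.
  by field; rewrite gt_eqF.
rewrite pmulr_lle0 ?invr_gt0 ?exprn_gt0// pmulr_lle0; last by lra.
move=> L2; apply/eqP; rewrite -sqrf_eq0 eq_le L2; exact: sqr_ge0.
Qed.

(** At the maximum point [y] the derivative in the coordinate direction [d] vanishes, and it is a
    multiple of the eigenvalue equation at [t]. *)
Lemma q_energy_max_eigen (b : R) (y : T -> R) :
    (forall x, q_energy b e x <= 0) -> q_energy b e y = 0 ->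
  forall t, \sum_u (e t u)%:R * (y t + y u) = b * y t.
Proof.
move=> le0 y0 t; pose d u : R := (u == t)%:R.
have sumd F : \sum_u d u * F u = F t.
  rewrite (bigD1 t)//= /d eqxx mul1r big1 ?addr0// => u /negPf->.
  by rewrite mul0r.
apply/eqP; rewrite -subr_eq0; apply/eqP.
apply: (@linear_coef_eq0 _ (q_energy b e d / 2)) => s.
have := le0 (fun u => y u + s * d u).
suff -> : q_energy b e (fun u => y u + s * d u) = q_energy b e y +
  2 * s * (2 * (\sum_u (e t u)%:R * (y t + y u) - b * y t))
  + s ^+ 2 * q_energy b e d by rewrite y0; lra.
have -> : \sum_u (e t u)%:R * (y t + y u) - b * y t =
   \sum_v d v * (\sum_u (e v u)%:R * (y v + y u)) - b * \sum_v d v * y v.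
  by rewrite sumd sumd.
rewrite mulrBr -polar_sum !q_energyE.
have -> : \sum_v (y v + s * d v) ^+ 2 = \sum_v y v ^+ 2
    + 2 * s * (\sum_v d v * y v) + s ^+ 2 * \sum_v d v ^+ 2.
  by rewrite !mulr_sumr -!big_split; apply: eq_bigr => v _ /=; ring.
have -> : \sum_v \sum_u (e v u)%:R * (y v + s * d v + (y u + s * d u)) ^+ 2 =
    \sum_v \sum_u (e v u)%:R * (y v + y u) ^+ 2
    + 2 * s * (\sum_v \sum_u (e v u)%:R * ((y v + y u) * (d v + d u)))
    + s ^+ 2 * \sum_v \sum_u (e v u)%:R * (d v + d u) ^+ 2.
  rewrite !mulr_sumr -!big_split; apply: eq_bigr => v _ /=.
  by rewrite !mulr_sumr -!big_split; apply: eq_bigr => u _ /=; ring.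
ring.
Qed.

(** At a zero of [y] the equation makes a sum of nonnegative terms vanish, so the zero spreads to
    the neighbours and, by connectedness, everywhere. *)
Lemma nonneg_eigen_gt0 (b : R) (y : T -> R) : connected_graph e ->
    (forall t, 0 <= y t) -> (exists t, y t != 0) ->
    (forall t, \sum_u (e t u)%:R * (y t + y u) = b * y t) ->
  forall t, 0 < y t.
Proof.
move=> e_conn y_ge0 [t0 yt0] yE t; rewrite lt_neqAle y_ge0 andbT eq_sym.
apply: contra yt0 => /eqP yt.
have step v u : e v u -> y v = 0 -> y u = 0.
  move=> vu yv; have := yE v; rewrite yv mulr0 => /eqP.
  rewrite psumr_eq0; last by move=> i _; rewrite add0r mulr_ge0.
  by move=> /allP/(_ u (mem_index_enum u)) /=; rewrite vu add0r mul1r => /eqP.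
have /connectP[p pP ->] := e_conn t t0.
elim: p t yt pP => [|v p IH] t yt /=; first by rewrite yt.
by case/andP => tv; apply: IH; exact: step yt.
Qed.

Lemma partite_eigen (w : nat) (c : T -> 'I_w) (m : R) : 0 <= m ->
    complete_partite e c -> T ->
    \sum_i part_weight m #|[set a | c a == i]| = 1 ->
  eigenvalue (signless_laplacian R e) (#|T|%:R + m).
Proof.
move=> m_ge0 ec t0 W1; pose s i := #|[set a | c a == i]|.
(* The values at which the tangent bounds of [partite_energy_le] are sharp, for total sum 1. *)
pose x t := (m + 2 * (s (c t))%:R)^-1 : R.
have d_gt0 t : 0 < m + 2 * (s (c t))%:R.
  rewrite ltr_wpDl// mulr_gt0// ltr0n; apply/card_gt0P; exists t.
  by rewrite inE.
apply/eigenvalue_signlessP; exists x; split.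
  by exists t0; rewrite /x invr_eq0 gt_eqF.
have sumx : \sum_u x u = 1.
  rewrite -[RHS]W1 (partition_big c xpredT) //=; apply: eq_bigr => i _.
  rewrite /part_weight -/(s i) mulr_natl -sumr_const.
  by apply: eq_big => [u|u /eqP ui]; rewrite ?inE// /x ui.
move=> t; have xm : (m + 2 * (s (c t))%:R) * x t = 1.
  by rewrite /x mulfV// gt_eqF.
have -> : \sum_u (e t u)%:R * (x t + x u) =
    \sum_u (x t + x u) - \sum_(u | c u == c t) (x t + x u).
  rewrite [X in _ = X - _](bigID (fun b => c b == c t)) /= addrAC subrr add0r.
  rewrite [RHS]big_mkcond; apply: eq_bigr => u _; rewrite ec eq_sym.
  by case: eqP; rewrite ?mul0r ?mul1r.
rewrite big_split /= sumx sumr_const.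
have -> : \sum_(u | c u == c t) (x t + x u) = (s (c t))%:R * (2 * x t).
  rewrite /s mulr_natl -sumr_const; apply: eq_big => [u|u /eqP cu]; rewrite ?inE//.
  by rewrite /x cu; ring.
rewrite -[x t *+ _]mulr_natl; lra.
Qed.

End SignlessLaplacian.

(** * Extremal graphs for [q1] under a clique bound *)

Lemma sum_part_card (T : finType) (w : nat) (c : T -> 'I_w) :
  (\sum_i #|[set a | c a == i]| = #|T|)%N.
Proof.
rewrite -[RHS]sum1_card (partition_big c xpredT) //=; apply: eq_bigr => i _.
by rewrite -sum1_card; apply: eq_bigl => a; rewrite inE.
Qed.

Section Extremal.
Variables (R : realType) (T : finType) (e : rel T) (w k r : nat).
Hypotheses (e_sym : symmetric e) (e_irr : irreflexive e).
Hypothesis e_cliques : clique_bounded e [set: T] w.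
Hypotheses (w_ge2 : (2 <= w)%N) (k_gt0 : (0 < k)%N) (r_lt : (r < w)%N).
Hypothesis card_T : #|T| = (k * w + r)%N.

Let b : R := turan_bound R w k r.
Let m : R := b - #|T|%:R.

Let mP : [/\ 0 <= m, (2 < w)%N -> 0 < m, w = 2%N -> m = 0 &
    r%:R * part_weight m k.+1 + (w%:R - r%:R) * part_weight m k = 1].
Proof. by rewrite /m card_T; exact: turan_bound_spec. Qed.

Let bE : b = #|T|%:R + m. Proof. by rewrite /m addrC subrK. Qed.

Lemma partite_q_energy_le (c : T -> 'I_w) (z : T -> R) :
  q_energy b (partite_rel c) z <=
  2 * (\sum_t z t) ^+ 2 * (\sum_i part_weight m #|[set a | c a == i]| - 1).
Proof. by case: mP => m_ge0 *; rewrite bE; exact: partite_energy_le. Qed.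

Lemma weight_le1 (c : T -> 'I_w) : \sum_i part_weight m #|[set a | c a == i]| <= 1.
Proof.
case: mP => m_ge0 _ _ <-; apply: sum_part_weight_le => //.
by rewrite sum_part_card.
Qed.

Lemma partite_q_energy_le0 (c : T -> nat) (z : T -> R) :
  {in [set: T], forall a, (c a < w)%N} -> q_energy b (partite_rel c) z <= 0.
Proof.
move=> clt; pose c' a := Ordinal (clt a (finset.in_setT a)).
apply: le_trans (partite_q_energy_le c' z) _.
by rewrite mulr_ge0_le0 ?subr_le0 ?weight_le1// mulr_ge0// sqr_ge0.
Qed.

Lemma q_energy_le0 (x : T -> R) : q_energy b e x <= 0.
Proof.
have [||c [z [clt le]]] := @turan_energy_le R T (@sq_kappa R) _
  (fun s => - (2 * b * s ^+ 2)) [set: T] e x w e_sym e_irr _ e_cliques.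
- by move=> s t; rewrite /sq_kappa addrC.
- by move=> s t; exact: sqr_ge0.
by apply: le_trans le _; exact: partite_q_energy_le0.
Qed.

Lemma q1_le_turan_bound : q1 R e <= b.
Proof.
have T_gt0 : (0 < #|T|)%N by rewrite card_T addn_gt0 muln_gt0 k_gt0 (ltnW w_ge2).
have [/(eigenvalue_signlessP e_sym)[x [[t xt] xE]] _] := q1P R T_gt0 e_sym.
have := q_energy_norm_ge e (q1 R e) b x.
rewrite (eigen_q_energy e_sym xE) add0r => /le_trans/(_ (q_energy_le0 _)).
have x_gt0 : 0 < \sum_t x t ^+ 2.
  rewrite (bigD1 t)//= ltr_pwDl//; first by rewrite lt_neqAle sqr_ge0 eq_sym sqrf_eq0 xt.
  by apply: sumr_ge0 => u _; exact: sqr_ge0.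
by rewrite pmulr_lle0// pmulr_rle0// subr_le0.
Qed.

Lemma q1_eq_partite : connected_graph e -> q1 R e = b ->
  exists c : T -> 'I_w, complete_partite e c /\
    1 <= \sum_i part_weight m #|[set a | c a == i]|.
Proof.
move=> e_conn q1b.
have T_gt0 : (0 < #|T|)%N by rewrite card_T addn_gt0 muln_gt0 k_gt0 (ltnW w_ge2).
have [/(eigenvalue_signlessP e_sym)[x [[t xt] xE]] _] := q1P R T_gt0 e_sym.
rewrite q1b in xE; pose y u := `|x u|.
have y0 : q_energy b e y = 0.
  apply/eqP; rewrite eq_le q_energy_le0 /=.
  have := q_energy_norm_ge e b b x.
  by rewrite (eigen_q_energy e_sym xE) add0r subrr mulr0 mul0r.
have y_gt0 : forall u, 0 < y u.
  apply: (nonneg_eigen_gt0 (b := b) e_conn).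
  - by move=> u; exact: normr_ge0.
  - by exists t; rewrite normr_eq0.
  - exact: (q_energy_max_eigen e_sym q_energy_le0).
have [||c [clt cP]] := @turan_energy_lt R T (@sq_kappa R) _
  (fun s => - (2 * b * s ^+ 2)) [set: T] e y w e_sym e_irr _ e_cliques.
- by move=> s s'; rewrite /sq_kappa addrC.
- by move=> u v; rewrite exprn_gt0// addr_gt0.
case: cP => [[z]|ec].
  by rewrite -/(q_energy b e y) y0 ltNge (partite_q_energy_le0 z clt).
pose c' a := Ordinal (clt a (finset.in_setT a)).
have ec' : complete_partite e c' by move=> u v; rewrite ec ?inE.
exists c'; split=> //.
(* The energy of [y] is 0 and its sum is positive, so this upper bound forces the total weight up to
   at least 1. *)
have := partite_q_energy_le c' y.
have -> : q_energy b (partite_rel c') y = q_energy b e y.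
  rewrite !q_energyE; congr (_ - _); apply: eq_bigr => u _.
  by apply: eq_bigr => v _; rewrite ec'.
have S_gt0 : 0 < \sum_u y u.
  by rewrite (bigD1 t)//= ltr_pwDl// sumr_ge0// => u _; exact: ltW.
by rewrite y0 pmulr_rge0 ?subr_ge0// mulr_gt0// exprn_gt0.
Qed.

Lemma partite_q1_eq (c : T -> 'I_w) : complete_partite e c ->
  \sum_i part_weight m #|[set a | c a == i]| = 1 -> q1 R e = b.
Proof.
move=> ec W1; apply/eqP; rewrite eq_le q1_le_turan_bound /=.
have T_gt0 : (0 < #|T|)%N by rewrite card_T addn_gt0 muln_gt0 k_gt0 (ltnW w_ge2).
have [_ max_q1] := q1P R T_gt0 e_sym; apply: max_q1.
case: mP => m_ge0 *; rewrite bE; have /card_gt0P[t _] := T_gt0.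
exact: partite_eigen ec t W1.
Qed.

Lemma q1_eq_turan : connected_graph e -> (3 <= w)%N ->
  (q1 R e = b <-> is_turan w e).
Proof.
move=> e_conn w_ge3; have [m_ge0 /(_ w_ge3) m_gt0 _ W1] := mP.
have divT : (#|T| %/ w = k)%N by rewrite card_T divnMDl ?divn_small ?addn0//; lia.
(* Floor and ceiling agree exactly when [r = 0], hence the case split. *)
have ceilT : ceil_div #|T| w = if r == 0%N then k else k.+1.
  rewrite /ceil_div card_T -addnA divnMDl; last by lia.
  case: eqP => [->|r0]; first by rewrite add0n divn_small ?addn0//; lia.
  have -> : (r + w.-1 = 1 * w + r.-1)%N by lia.
  by rewrite divnMDl ?divn_small ?addn0 ?addn1//; lia.
split=> [/(q1_eq_partite e_conn)[c [ec W_ge1]]|[c [ec cP]]].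
  have sum_s := sum_part_card c; rewrite [in RHS]card_T in sum_s.
  have sP := sum_part_weight_eq (s := fun i => #|[set a | c a == i]|) m_gt0 k_gt0 sum_s.
  rewrite W1 in sP; have {}sP := sP W_ge1.
  exists c; split=> // i; rewrite divT ceilT.
  case: (sP i) => /= si; first by left.
  (* With [r = 0] a part of size [k.+1] is impossible: the other [w.-1] parts have at least [k]
     vertices each, and the total would exceed [k * w]. *)
  right; case: eqP => // r0; exfalso; move: sum_s; rewrite r0 addn0 (bigD1 i)//= si.
  have : (w.-1 * k <= \sum_(j < w | j != i) #|[set a | c a == j]|)%N.
    have <- : (\sum_(j < w | j != i) k = w.-1 * k)%N.
      by rewrite sum_nat_const cardC1 card_ord.
    by apply: leq_sum => j _; case: (sP j) => /= ->.
  have -> : (k * w = k + w.-1 * k)%N.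
    by rewrite -{1}(prednK (ltnW w_ge2)) mulnS mulnC.
  by move: (\sum_(j < w | j != i) _)%N => X; lia.
apply: (partite_q1_eq ec); rewrite -W1.
apply: (sum_part_weight_balanced (s := fun i => #|[set a | c a == i]|)) => //.
  by rewrite sum_part_card.
by move=> i; move: (cP i); rewrite divT ceilT; case: ifP => // _; tauto.
Qed.

End Extremal.

(** * From the clique number to the bound and its equality cases *)

Theorem theorem1p3 (R : realType) (T : finType) (e : rel T) (n w k r : nat)
    (e_simple : simple_graph e) (e_conn : connected_graph e)
    (card_T : #|T| = n) (clique_e : clique_number e = w)
    (w_ge2 : (2 <= w)%N) (n_div : n = (k * w + r)%N) (r_lt : (r < w)%N) :
  let bound : R :=
    ((3 * w%:R - 4) * k%:R + 3 * r%:R - 2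
     + Num.sqrt (k%:R ^+ 2 * w%:R ^+ 2
                 + ((2 * r%:R + 4) * w%:R - 8 * r%:R) * k%:R
                 + (r%:R - 2) ^+ 2)) / 2 in
  q1 R e <= bound
  /\ (w = 2%N -> (q1 R e = bound <-> complete_bipartite e))
  /\ ((3 <= w)%N -> (q1 R e = bound <-> is_turan w e)).
Proof.
have [e_sym e_irr] := e_simple; move=> bound.
have e_cliques : clique_bounded e [set: T] w.
  by move=> K Kc _; rewrite -clique_e; exact: (leq_bigmax_cond (P := clique e)).
have w_le_T : (w <= #|T|)%N.
  by rewrite -clique_e; apply/bigmax_leqP => A _; exact: max_card.
have cardE : #|T| = (k * w + r)%N by rewrite card_T.
(* If [k] were 0, a clique of [w] vertices would sit in a graph of order [r < w]. *)
have k_gt0 : (0 < k)%N.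
  by rewrite lt0n; apply/eqP => k0; move: w_le_T; rewrite cardE k0 leqNgt r_lt.
rewrite -[bound]/(turan_bound R w k r).
split; first exact: q1_le_turan_bound.
split; last by move=> w_ge3; exact: q1_eq_turan.
move=> w2; split=> [q1b|[c [ec c_onto]]].
  have [c [ec _]] := q1_eq_partite e_sym e_irr e_cliques w_ge2 k_gt0 r_lt cardE e_conn q1b.
  (* Clique number 2 provides an edge, whose ends carry the two colours; thus neither part is
     empty. *)
  have [x [y xy]] : exists x y, e x y.
    apply: contrapT => no_edge; suff : (clique_number e <= 1)%N by rewrite clique_e w2.
    apply/bigmax_leqP => A /forall_inP Ac; apply/card_le1_eqP => y x yA xA.
    apply/eqP/negPn/negP => xy; apply: no_edge; exists x, y.
    by have /forall_inP/(_ y yA)/implyP/(_ xy) := Ac x xA.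
  clear clique_e; subst w; exists c; split=> // i; move: xy; rewrite ec => cxy.
  have [<-|xi] := eqVneq (c x) i; first by exists x.
  exists y; apply/val_inj => /=; move: cxy xi; rewrite -!val_eqE /=.
  by move: (ltn_ord (c x)) (ltn_ord (c y)) (ltn_ord i); lia.
have [m_ge0 _ /(_ w2) m0 W1] := turan_bound_spec R w_ge2 k_gt0 r_lt.
clear clique_e; subst w.
apply: (partite_q1_eq e_sym e_irr e_cliques w_ge2 k_gt0 r_lt cardE ec).
rewrite cardE m0 big_ord_recl big_ord1.
(* At [m = 0] a nonempty part weighs 1/2 whatever its size, so the two parts together weigh 1. *)
have half i : part_weight 0 #|[set a | c a == i]| = 2^-1 :> R.
  have [x xi] := c_onto i.
  have s_neq0 : #|[set a | c a == i]|%:R != 0 :> R.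
    by rewrite pnatr_eq0 -lt0n; apply/card_gt0P; exists x; rewrite inE xi.
  by rewrite /part_weight add0r; field.
by rewrite !half; field.
Qed.
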